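(* Every $P_F$-frame is an $F$-frame.
   Context: A frame is a complete lattice $L$ (top $1$, bottom $0$) satisfying $a\wedge\bigvee S=\bigvee\{a\wedge s\mid s\in S\}$ for all $a\in L$, $S\subseteq L$. For $a\in L$ the pseudocomplement is $a^*=\bigvee\{x\in L\mid x\wedge a=0\}$, and $a$ is complemented if $a\vee a^*=1$. Write $a\prec b$ if there is $t\in L$ with $a\wedge t=0$ and $t\vee b=1$; write $a\prec\!\prec b$ if there is a family $(c_q)$ indexed by $\mathbb{Q}\cap[0,1]$ with $c_0=a$, $c_1=b$ and $c_r\prec c_s$ whenever $r<s$. $L$ is completely regular if $a=\bigvee\{x\in L\mid x\prec\!\prec a\}$ for all $a\in L$. Throughout, all frames are assumed completely regular. An element $a\in L$ is a cozero element if there is a sequence $(a_n)$ with $a_n\prec\!\prec a$ for each $n$ and $a=\bigvee_n a_n$ (equivalently, $a=\mathrm{coz}\,\varphi$ for some real-valued continuous function $\varphi$ on $L$); $\mathrm{Coz}\,L$ is the set of cozero elements. $L$ is a $P_F$-frame if whenever $a,b\in\mathrm{Coz}\,L$ satisfy $a\wedge b=0$, at least one of $a,b$ is complemented. Let $\mathcal{L}(\mathbb{R})$ be the frame of reals (generated by pairs $(p,q)$ of rationals subject to $(p,q)\wedge(r,s)=(p\vee r,q\wedge s)$; $(p,q)\vee(r,s)=(p,s)$ when $p\le r<q\le s$; $(p,q)=\bigvee\{(r,s)\mid p<r<s<q\}$; $1=\bigvee\{(p,q)\mid p,q\in\mathbb{Q}\}$). A frame homomorphism $g:\mathcal{L}(\mathbb{R})\to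 M$ is bounded if $g(p,q)=1$ for some $p,q\in\mathbb{Q}$. An onto frame homomorphism $\pi:L\to M$ is a $C^*$-quotient if for every bounded frame homomorphism $g:\mathcal{L}(\mathbb{R})\to M$ there is a frame homomorphism $\tilde g:\mathcal{L}(\mathbb{R})\to L$ with $g=\pi\tilde g$. $L$ is an $F$-frame if for each $a\in\mathrm{Coz}\,L$ the map $L\to\downarrow\! a=\{x\in L\mid x\le a\}$, $x\mapsto a\wedge x$, is a $C^*$-quotient; it is known that $L$ is an $F$-frame if and only if whenever $a,b\in\mathrm{Coz}\,L$ with $a\wedge b=0$ there exist $c,d\in\mathrm{Coz}\,L$ with $c\vee d=1$ and $c\wedge a=0=d\wedge b$. *)

(* Defs.v *)
From HB Require Import structures.
From mathcomp Require Import all_boot all_order all_algebra.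
From mathcomp Require Import boolp classical_sets.

Set Implicit Arguments.
Unset Strict Implicit.
Unset Printing Implicit Defensive.

Import Order.TTheory.
Local Open Scope order_scope.

HB.mixin Record TBDistrLattice_isFrame d T of Order.TBDistrLattice d T := {
  fsup : set T -> T;
  fsup_le : forall (S : set T) (x : T),
    (fsup S <= x) <-> (forall y : T, S y -> y <= x);
  meet_fsup : forall (a : T) (S : set T),
    a `&` fsup S = fsup [set (a `&` s)%O | s in S]%classic
}.

#[short(type="frameType")]
HB.structure Definition Frame d :=
  { T of Order.TBDistrLattice d T & TBDistrLattice_isFrame d T }.

HB.factory Record POrder_isFrame d T of Order.POrder d T := {
  fmeet : T -> T -> T;
  lefI : forall x y z : T, (x <= fmeet y z) = (x <= y) && (x <= z);
  sup : set T -> T;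
  sup_le : forall (S : set T) (x : T),
    (sup S <= x) <-> (forall y : T, S y -> y <= x);
  fmeet_sup : forall (a : T) (S : set T),
    fmeet a (sup S) <= sup [set fmeet a s | s in S]%classic
}.

HB.builders Context d T of POrder_isFrame d T.

Let fjoin (x y : T) : T := sup [set z | z = x \/ z = y]%classic.

Fact lefU (x y z : T) : (fjoin x y <= z) = (x <= z) && (y <= z).
Proof.
apply/idP/andP => [/sup_le h|[xz yz]]; last by apply/sup_le => _ [] ->.
by split; apply: h; [left|right].
Qed.

HB.instance Definition _ :=
  Order.POrder_MeetJoin_isLattice.Build d T lefI lefU.

Fact le0f (x : T) : sup set0 <= x.
Proof. by apply/sup_le. Qed.

Fact lef1 (x : T) : x <= sup setT.
Proof. by have /sup_le := lexx (sup setT); apply. Qed.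

HB.instance Definition _ := Order.hasBottom.Build d T le0f.
HB.instance Definition _ := Order.hasTop.Build d T lef1.

Fact fmeetUl : @left_distributive T T Order.meet Order.join.
Proof.
move=> x y z; apply/le_anti/andP; split; last first.
  by rewrite leUx; apply/andP; split; apply: leI2; rewrite ?leUl ?leUr.
rewrite meetC; apply: (le_trans (fmeet_sup _ _)).
by apply/sup_le => _ [w [->|->] <-]; rewrite -[fmeet _ _]/(_ `&` _) meetC
  ?leUl ?leUr.
Qed.

HB.instance Definition _ := Order.Lattice_Meet_isDistrLattice.Build d T fmeetUl.

Fact fmeet_supE (a : T) (S : set T) :
  a `&` sup S = sup [set (a `&` s)%O | s in S]%classic.
Proof.
apply/le_anti/andP; split; first exact: fmeet_sup.
apply/sup_le => _ [s Ss <-]; rewrite lexI leIl /=.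
by apply: (le_trans (leIr _ _)); have /sup_le := lexx (sup S); apply.
Qed.

HB.instance Definition _ :=
  TBDistrLattice_isFrame.Build d T sup_le fmeet_supE.

HB.end.

Section FrameTheory.
Context {d : Order.disp_t} {L : frameType d}.
Implicit Types (S : set L) (x y : L).

Lemma fsup_ub S x : S x -> x <= fsup S.
Proof. by move=> Sx; have /fsup_le := lexx (fsup S); apply. Qed.

End FrameTheory.

(* Finite meets and arbitrary joins; preservation of [\bot] and of binary
   joins is the case of the empty set and of pairs. *)
Definition frame_hom d d' (L : frameType d) (M : frameType d') (f : L -> M) :=
  [/\ f \top = \top,
      forall x y, f (x `&` y) = f x `&` f y
    & forall S : set L, f (fsup S) = fsup [set f x | x in S]%classic].

Section Frames.
Context {d : Order.disp_t} {L : frameType d}.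
Implicit Types a b x : L.

Definition pseudocompl a : L := fsup [set x | (x `&` a)%O = \bot]%classic.

Definition complemented a : Prop := a `|` pseudocompl a = \top.

Definition rather_below a b : Prop :=
  exists t : L, a `&` t = \bot /\ t `|` b = \top.

(* Only the values of [c] on the rationals of [0, 1] matter. *)
Definition completely_below a b : Prop :=
  exists c : rat -> L,
    [/\ c 0%R = a, c 1%R = b
      & forall r s : rat,
          (0%R <= r) -> (r < s) -> (s <= 1%R) -> rather_below (c r) (c s)].

Definition cozero a : Prop :=
  exists u : nat -> L,
    (forall n, completely_below (u n) a) /\ a = fsup (range u).

End Frames.

Definition completely_regular d (L : frameType d) : Prop :=
  forall a : L, a = fsup [set x | completely_below x a]%classic.

Definition PF_frame d (L : frameType d) : Prop :=
  forall a b : L, cozero a -> cozero b -> a `&` b = \bot ->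
    complemented a \/ complemented b.

Definition downset d (L : porderType d) (a : L) : Type := {x : L | x <= a}.

HB.instance Definition _ d (L : porderType d) (a : L) :=
  SubType.copy (downset a) {x : L | x <= a}.
HB.instance Definition _ d (L : porderType d) (a : L) :=
  [Choice of downset a by <:].
HB.instance Definition _ d (L : porderType d) (a : L) :=
  [SubChoice_isSubPOrder of downset a by <: with d].

Section Downset.
Context {d : Order.disp_t} {L : frameType d} (a : L).
Implicit Types x y z : downset a.

Fact down_proj_subproof (x : L) : a `&` x <= a.
Proof. exact: leIl. Qed.

Definition down_proj (x : L) : downset a := Sub (a `&` x) (down_proj_subproof x).

Fact down_meet_subproof x y : val x `&` val y <= a.
Proof. by have xa : val x <= a := valP x; rewrite (leIxl _ xa). Qed.

Definition down_meet x y : downset a :=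
  Sub (val x `&` val y) (down_meet_subproof x y).

Fact down_sup_subproof (S : set (downset a)) :
  fsup [set val x | x in S]%classic <= a.
Proof. by apply/fsup_le => _ [x _ <-]; have xa : val x <= a := valP x. Qed.

Definition down_sup (S : set (downset a)) : downset a :=
  Sub (fsup [set val x | x in S]%classic) (down_sup_subproof S).

Fact le_down_meet x y z : (x <= down_meet y z) = (x <= y) && (x <= z).
Proof. by rewrite -!Order.le_val SubK lexI. Qed.

Fact down_sup_le (S : set (downset a)) x :
  (down_sup S <= x) <-> (forall y, S y -> y <= x).
Proof.
rewrite -Order.le_val SubK; split=> [/fsup_le h y Sy|h].
  by rewrite -Order.le_val; apply: h; exists y.
by apply/fsup_le => _ [y /h + <-]; rewrite -Order.le_val.
Qed.

Fact down_meet_sup x (S : set (downset a)) :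
  down_meet x (down_sup S) <= down_sup [set down_meet x s | s in S]%classic.
Proof.
rewrite -Order.le_val !SubK meet_fsup; apply/fsup_le => _ [_ [s Ss <-] <-].
by apply: fsup_ub; exists (down_meet x s); [exists s|rewrite SubK].
Qed.

HB.instance Definition _ :=
  POrder_isFrame.Build d (downset a) le_down_meet down_sup_le down_meet_sup.

End Downset.

(* The frame presented by the generators [(p, q)] and the relations
   [real_relations] below, built as the frame of those sets of generators that
   are down-closed for [(p, q) <= (r, s) := r <= p /\ q <= s] and closed under
   the two covering relations.  [real_gen_relations], [frame_reals_univ] and
   [frame_reals_uniq] show that it has the universal property. *)

Record real_ideal (U : rat -> rat -> Prop) : Prop := RealIdeal {
  real_ideal_down : forall p q r s, r <= p -> q <= s -> U r s -> U p q;
  real_ideal_glue : forall p q r s,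
    p <= r -> r < q -> q <= s -> U p q -> U r s -> U p s;
  real_ideal_inner : forall p q,
    (forall r s, p < r -> r < s -> s < q -> U r s) -> U p q
}.

Record frame_reals : Type := FrameReals {
  real_mem :> rat -> rat -> Prop;
  real_memP : real_ideal real_mem
}.

Lemma real_eq (U V : frame_reals) : (forall p q, U p q <-> V p q) -> U = V.
Proof.
case: U V => [U hU] [V hV] /= UV.
have E : U = V by apply/funext => p; apply/funext => q; apply/propext.
by subst V; congr FrameReals; apply: Prop_irrelevance.
Qed.

HB.instance Definition _ := gen_eqMixin frame_reals.
HB.instance Definition _ := gen_choiceMixin frame_reals.

Definition real_le (U V : frame_reals) : bool := `[< forall p q, U p q -> V p q >].

Fact real_le_refl : reflexive real_le.
Proof. by move=> U; apply/asboolP. Qed.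

Fact real_le_anti : antisymmetric real_le.
Proof.
move=> U V /andP[/asboolP UV /asboolP VU].
by apply: real_eq => p q; split=> [/UV|/VU].
Qed.

Fact real_le_trans : transitive real_le.
Proof.
move=> V U W /asboolP UV /asboolP VW.
by apply/asboolP => p q /UV /VW.
Qed.

Fact frame_reals_display : Order.disp_t. Proof. exact: Order.Disp tt tt. Qed.

HB.instance Definition _ := Order.Le_isPOrder.Build frame_reals_display
  frame_reals real_le_refl real_le_anti real_le_trans.

Lemma real_leP (U V : frame_reals) :
  (U <= V) <-> (forall p q, U p q -> V p q).
Proof. by split=> [/asboolP|h]; last exact/asboolP. Qed.

Fact real_meet_subproof (U V : frame_reals) :
  real_ideal (fun p q => U p q /\ V p q).
Proof.
case: U V => [U [dU gU iU]] [V [dV gV iV]] /=; split.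
- by move=> p q r s rp qs [/dU Ur /dV Vr]; split; [apply: Ur|apply: Vr].
- move=> p q r s pr rq qs [U1 V1] [U2 V2].
  by split; [apply: gU U1 U2|apply: gV V1 V2].
- by move=> p q h; split; [apply: iU|apply: iV] => r s pr rs sq;
    case: (h r s pr rs sq).
Qed.

Definition real_meet (U V : frame_reals) := FrameReals (real_meet_subproof U V).

Fact real_sup_subproof (S : set frame_reals) :
  real_ideal (fun p q => forall W : frame_reals,
    (forall U, S U -> U <= W) -> W p q).
Proof.
split.
- move=> p q r s rp qs h W /h; exact: (real_ideal_down (real_memP W)).
- move=> p q r s pr rq qs h1 h2 W hW.
  exact: (real_ideal_glue (real_memP W) pr rq qs (h1 W hW) (h2 W hW)).
- move=> p q h W hW; apply: (real_ideal_inner (real_memP W)) => r s pr rs sq.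
  exact: h.
Qed.

Definition real_sup (S : set frame_reals) := FrameReals (real_sup_subproof S).

Fact le_real_meet (U V W : frame_reals) :
  (U <= real_meet V W) = (U <= V) && (U <= W).
Proof.
apply/idP/andP => [/real_leP h|[/real_leP UV /real_leP UW]].
  by split; apply/real_leP => p q /h [].
by apply/real_leP => p q Upq; split; [apply: UV|apply: UW].
Qed.

Fact real_sup_le (S : set frame_reals) (U : frame_reals) :
  (real_sup S <= U) <-> (forall V, S V -> V <= U).
Proof.
split=> [/real_leP h V SV|h]; last by apply/real_leP => p q; apply.
by apply/real_leP => p q Vpq; apply: h => W /(_ V SV) /real_leP; apply.
Qed.

Fact real_imp_subproof (U W : frame_reals) :
  real_ideal (fun p q => forall x y, p <= x -> y <= q -> U x y -> W x y).
Proof.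
case: U W => [U [dU gU iU]] [W [dW gW iW]] /=; split.
- move=> p q r s rp qs h x y px yq; apply: h; first exact: le_trans px.
  exact: le_trans qs.
- move=> p q r s pr rq qs h1 h2 x y px ys Uxy.
  have [yq|qy] := leP y q; first exact: h1.
  have [rx|xr] := leP r x; first exact: h2.
  apply: (gW x q r y) => //; rewrite ?ltW //.
    by apply: h1 => //; apply: dU Uxy => //; apply: ltW.
  by apply: h2 => //; apply: dU Uxy => //; apply: ltW.
- move=> p q h x y px yq Uxy; apply: iW => r s xr rs sy.
  apply: (h r s) => //; first exact: le_lt_trans xr.
    exact: lt_le_trans yq.
  by apply: dU Uxy; apply: ltW.
Qed.

Fact real_meet_sup (U : frame_reals) (S : set frame_reals) :
  real_meet U (real_sup S) <= real_sup [set real_meet U V | V in S]%classic.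
Proof.
apply/real_leP => p q [Upq Spq] W hW.
apply: (Spq (FrameReals (real_imp_subproof U W)) _ p q) => //= V SV.
apply/real_leP => x y Vxy u v xu vy Uuv.
have /real_leP : real_meet U V <= W by apply: hW; exists V.
apply; split=> //; exact: (real_ideal_down (real_memP V)) Vxy.
Qed.

HB.instance Definition _ := POrder_isFrame.Build frame_reals_display
  frame_reals le_real_meet real_sup_le real_meet_sup.

(* The generator [(p, q)]; it is [\bot] when [q <= p]. *)
Fact real_gen_subproof (p q : rat) :
  real_ideal (fun r s => s <= r \/ p <= r /\ s <= q).
Proof.
split.
- move=> r s u v ur sv [vu|[pu vq]].
    by left; apply: le_trans sv _; apply: le_trans vu ur.
  by right; split; [apply: le_trans ur|apply: le_trans sv _].
- move=> r s u v ru us sv [sr|[pr _]] [vu|[_ vq]]; last by right.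
  + by have := lt_le_trans us (le_trans sr ru); rewrite ltxx.
  + by have := lt_le_trans us (le_trans sr ru); rewrite ltxx.
  + by have := lt_le_trans us (le_trans sv vu); rewrite ltxx.
- move=> r s h; have [|rs] := leP s r; first by left.
  right; split; rewrite leNgt; apply/negP => lt1.
    have lt2 : r < Order.min p s by rewrite lt_min lt1 rs.
    have [l1 l2] := Num.Theory.midf_lt lt2; set m := (_ / _)%R in l1 l2.
    move: l2; rewrite lt_min => /andP[mp ms].
    have [l3 l4] := Num.Theory.midf_lt ms; set n := (_ / _)%R in l3 l4.
    case: (h m n l1 l3 l4) => [nm|[pm _]].
      by have := lt_le_trans l3 nm; rewrite ltxx.
    by have := lt_le_trans mp pm; rewrite ltxx.
  have lt2 : Order.max q r < s by rewrite gt_max lt1 rs.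
  have [l1 l2] := Num.Theory.midf_lt lt2; set m := (_ / _)%R in l1 l2.
  move: l1; rewrite gt_max => /andP[qm rm].
  have [l3 l4] := Num.Theory.midf_lt rm; set n := (_ / _)%R in l3 l4.
  case: (h n m l3 l4 l2) => [mn|[_ mq]].
    by have := lt_le_trans l4 mn; rewrite ltxx.
  by have := lt_le_trans qm mq; rewrite ltxx.
Qed.

Definition real_gen (p q : rat) : frame_reals := FrameReals (real_gen_subproof p q).

Definition real_relations d (M : frameType d) (f : rat -> rat -> M) : Prop :=
  [/\ forall p q r s : rat, f p q `&` f r s = f (Order.max p r) (Order.min q s),
      forall p q r s : rat, p <= r -> r < q -> q <= s -> f p q `|` f r s = f p s,
      forall p q : rat,
        f p q = fsup [set f x.1 x.2 | x in
          [set x : rat * rat | [/\ p < x.1, x.1 < x.2 & x.2 < q]]]%classic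
    & \top = fsup [set f x.1 x.2 | x in [set: rat * rat]]%classic].

Lemma real_gen_le (p q : rat) (U : frame_reals) : (real_gen p q <= U) <-> U p q.
Proof.
split=> [/real_leP|Upq]; first by apply; right.
apply/real_leP => r s [sr|[pr sq]].
  apply: (real_ideal_inner (real_memP U)) => x y rx xy ys.
  by have := lt_le_trans (lt_trans rx (lt_trans xy ys)) sr; rewrite ltxx.
exact: (real_ideal_down (real_memP U)) Upq.
Qed.

Lemma real_fsup_gen (U : frame_reals) :
  U = fsup [set real_gen x.1 x.2 | x in [set x : rat * rat | U x.1 x.2]]%classic.
Proof.
apply/le_anti/andP; split; last first.
  by apply/fsup_le => _ [[p q] /= Upq <-]; apply/real_gen_le.
by apply/real_leP => p q Upq; apply/real_gen_le/fsup_ub; exists (p, q).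
Qed.

Lemma real_gen_relations : real_relations real_gen.
Proof.
split.
- move=> p q r s; apply/le_anti/andP; split; last first.
    rewrite lexI; apply/andP.
    by split; apply/real_gen_le; right; rewrite ge_min le_max !lexx ?orbT.
  apply/real_leP => x y [] [yx|[px yq]]; first by left.
  move=> [yx|[rx ys]]; first by left.
  by right; rewrite ge_max le_min px rx yq ys.
- move=> p q r s pr rq qs; apply/le_anti/andP; split.
    rewrite leUx; apply/andP.
    by split; apply/real_gen_le; right; rewrite ?lexx ?pr ?qs.
  apply/real_gen_le; apply: (real_ideal_glue (real_memP _) pr rq qs).
    by apply/real_gen_le; rewrite leUl.
  by apply/real_gen_le; rewrite leUr.
- move=> p q; apply/le_anti/andP; split; last first.
    apply/fsup_le => _ [[r s] /= [pr _ sq] <-]; apply/real_gen_le.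
    by right; rewrite !ltW.
  apply/real_gen_le; apply: (real_ideal_inner (real_memP _)) => r s pr rs sq.
  by apply/real_gen_le/fsup_ub; exists (r, s).
- apply/le_anti; rewrite lex1 andbT; apply/real_leP => p q _.
  by apply/real_gen_le/fsup_ub; exists (p, q).
Qed.

Lemma frame_reals_univ d (M : frameType d) (f : rat -> rat -> M) :
  real_relations f ->
  exists2 h : frame_reals -> M,
    frame_hom h & forall p q, h (real_gen p q) = f p q.
Proof.
move=> [fI fU fin ftop].
have fdown p q r s : r <= p -> q <= s -> f p q <= f r s.
  by move=> rp qs; rewrite leEmeet fI (max_l rp) (min_l qs).
have ideal (z : M) : real_ideal (fun p q => f p q <= z).
  split.
  - by move=> p q r s rp qs; apply: le_trans; apply: fdown.
  - by move=> p q r s pr rq qs h1 h2; rewrite -(fU _ _ _ _ pr rq qs) leUx h1 h2.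
  - move=> p q h; rewrite fin; apply/fsup_le => _ [[r s] /= [pr rs sq] <-].
    exact: h.
pose h (U : frame_reals) : M :=
  fsup [set f x.1 x.2 | x in [set x : rat * rat | U x.1 x.2]]%classic.
have h_le U z : (h U <= z) <-> (U <= FrameReals (ideal z)).
  split=> [/fsup_le hz|/real_leP Uz].
    by apply/real_leP => p q Upq; apply: hz; exists (p, q).
  by apply/fsup_le => _ [[p q] /= Upq <-]; apply: Uz.
have hmono U V : U <= V -> h U <= h V.
  move=> UV; apply/h_le; apply: le_trans UV _; exact/h_le.
exists h; last first.
  move=> p q; apply/le_anti/andP; split; first by apply/h_le/real_gen_le => /=.
  by apply: fsup_ub; exists (p, q) => //=; right.
split.
- apply/le_anti; rewrite lex1 /= ftop; apply/fsup_le => _ [[p q] _ <-].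
  apply: fsup_ub; exists (p, q) => //.
  by apply: (iffLR (real_gen_le p q \top)); apply: lex1.
- move=> U V; apply/le_anti/andP; split.
    by rewrite lexI !hmono ?leIl ?leIr.
  rewrite {2}/h meet_fsup; apply/fsup_le => _ [_ [[r s] /= Vrs <-] <-].
  rewrite meetC meet_fsup; apply/fsup_le => _ [_ [[p q] /= Upq <-] <-].
  rewrite fI; apply: fsup_ub => /=.
  exists (Order.max r p, Order.min s q) => //=; split.
    by apply: (real_ideal_down (real_memP U)) Upq; rewrite ?ge_min ?le_max lexx ?orbT.
  by apply: (real_ideal_down (real_memP V)) Vrs; rewrite ?ge_min ?le_max lexx ?orbT.
- move=> S; apply/le_anti/andP; split; last first.
    by apply/fsup_le => _ [U SU <-]; apply/hmono/fsup_ub.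
  apply/h_le/fsup_le => U SU; apply/h_le.
  by apply: fsup_ub; exists U.
Qed.

Lemma frame_reals_uniq d (M : frameType d) (g h : frame_reals -> M) :
  frame_hom g -> frame_hom h ->
  (forall p q, g (real_gen p q) = h (real_gen p q)) -> g =1 h.
Proof.
move=> [_ _ gS] [_ _ hS] gh U; rewrite (real_fsup_gen U) gS hS.
congr fsup; rewrite !image_comp; apply: eq_imagel => -[p q] _; exact: gh.
Qed.

Definition bounded d (M : frameType d) (g : frame_reals -> M) : Prop :=
  exists p q : rat, g (real_gen p q) = \top.

Definition Cstar_quotient d d' (L : frameType d) (M : frameType d')
    (f : L -> M) : Prop :=
  [/\ frame_hom f,
      forall y : M, exists x : L, f x = y
    & forall g : frame_reals -> M, frame_hom g -> bounded g ->
        exists2 g' : frame_reals -> L, frame_hom g' & g =1 f \o g'].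

Definition F_frame d (L : frameType d) : Prop :=
  forall a : L, cozero a -> Cstar_quotient (down_proj a).

(* Main.v *)
Require Import Defs.
From mathcomp Require Import all_boot all_order all_algebra.
From mathcomp Require Import boolp classical_sets.

(** Let [a] be a cozero element and [g] a bounded homomorphism from the reals
    to the frame [downset a].  Writing [U r = g(r, +oo)] and [V r = g(-oo, r)],
    the map [g] amounts to a scale: [U r] and [V r] are disjoint, and
    [U r `|` V s = a] when [r < s].  It extends to [L] as soon as [U] and [V]
    can be enlarged to a scale [D], [C] of [L] that covers [\top] instead of
    [a] ([frame_hom_of_scale], [scale_ext_round]): on [a], the disjointness of
    [D] and [C] squeezes [D] between nearby values of [U].

    Since [a] is cozero in [L], all the [U r] and [V r] are cozero in [L], not
    just in [downset a] ([scale_cozero]): an approximation of [U r] inside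
    [downset a] is cut down by an approximation of [a] inside [L].  So in a
    P_F-frame, for each [r], one of [U r], [V r] is complemented.

    If [a] is complemented, then [g] is extended by the constant [0] on the
    complement of [a] ([scale_ext_complemented]).  Otherwise, as
    [a = U r `|` V s] for [r < s], it cannot happen that [U r] and [V s] are
    both complemented with [r < s]; hence the rationals are cut into a lower
    part, where [V r] is complemented, and an upper part, where [U r] is.
    Taking for [D r] the complement of [V r] on the lower part and [U r] itself
    on the upper part gives a decreasing family of complemented elements, which
    is the required scale ([scale_ext_noncomplemented]): the extension takes
    outside [a] the value given by the cut. *)

Set Implicit Arguments.
Unset Strict Implicit.
Unset Printing Implicit Defensive.

Import Order.TTheory GRing.Theory Num.Theory.
Local Open Scope order_scope.

(** * Pseudocomplements and cozero elements *)

Section Elements.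
Context {d : Order.disp_t} {L : frameType d}.
Implicit Types a b x y : L.

Lemma fsup_mono_image (I : Type) (P Q : set I) (F : I -> L) :
  (forall i, P i -> Q i) ->
  fsup [set F i | i in P]%classic <= fsup [set F i | i in Q]%classic.
Proof.
by move=> PQ; apply/fsup_le => _ [i /PQ Qi <-]; apply: fsup_ub; exists i.
Qed.

Lemma fsup_pair x y : x `|` y = fsup [set z | z = x \/ z = y]%classic.
Proof.
apply/le_anti/andP; split.
  by rewrite leUx; apply/andP; split; apply: fsup_ub; [left|right].
by apply/fsup_le => _ [->|->]; rewrite ?leUl ?leUr.
Qed.

Lemma meet_fsup2 (I J : Type) (P : set I) (Q : set J) (F : I -> L) (G : J -> L) z :
  (forall i j, P i -> Q j -> F i `&` G j <= z) ->
  fsup [set F i | i in P]%classic `&` fsup [set G i | i in Q]%classic <= z.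
Proof.
move=> h; rewrite meet_fsup; apply/fsup_le => _ [_ [j Qj <-] <-].
rewrite meetC meet_fsup; apply/fsup_le => _ [_ [i Pi <-] <-].
by rewrite meetC; apply: h.
Qed.

Lemma le_pseudocompl x a : x `&` a = \bot -> x <= pseudocompl a.
Proof. by move=> xa; apply: fsup_ub. Qed.

Lemma meet_pseudocompl a : a `&` pseudocompl a = \bot.
Proof.
apply/le_anti; rewrite le0x andbT meet_fsup; apply/fsup_le => _ [x xa <-].
by rewrite meetC xa.
Qed.

Lemma complemented_bot : complemented (\bot : L).
Proof. by apply/le_anti; rewrite lex1 join0x le_pseudocompl ?meetx0. Qed.

Lemma complementedU a b :
  complemented a -> complemented b -> complemented (a `|` b).
Proof.
move=> ca cb; apply/le_anti; rewrite lex1 /=.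
apply: (@le_trans _ _ ((a `|` b) `|` (pseudocompl a `&` pseudocompl b))).
  rewrite joinIr lexI -{1}ca -{1}cb !leUx !leUr !andbT.
  by rewrite -!joinA leUl /= joinCA leUl.
rewrite leU2 //; apply: le_pseudocompl; rewrite meetUr.
rewrite -meetA (meetC (pseudocompl b)) meetA (meetC (pseudocompl a) a).
rewrite meet_pseudocompl meet0x join0x -meetA (meetC (pseudocompl b)).
by rewrite meet_pseudocompl meetx0.
Qed.

Lemma rather_below_le a b : rather_below a b -> a <= b.
Proof.
move=> [t [at0 tb]]; rewrite leEmeet -{2}(meetx1 a) -tb meetUr at0 join0x.
by [].
Qed.

Lemma completely_below_bot b : completely_below \bot b.
Proof.
exists (fun q => if q == 1%R then b else \bot); split=> //.
move=> r s _ rs s1; rewrite (lt_eqF (lt_le_trans rs s1)).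
by exists \top; rewrite meet0x join1x.
Qed.

Lemma cozero_countable (I : countType) (u : I -> L) b :
  (forall i, completely_below (u i) b) -> b = fsup (range u) -> cozero b.
Proof.
move=> ub bu; exists (fun n => if unpickle n is Some i then u i else \bot).
split=> [n|]; first by case: unpickle => // *; apply: completely_below_bot.
rewrite {1}bu; apply/le_anti/andP; split; apply/fsup_le => y [].
  by move=> i _ <-; apply: fsup_ub; exists (pickle i) => //; rewrite pickleK.
move=> n _ <-; case: unpickle => [i|]; last exact: le0x.
by apply: fsup_ub; exists i.
Qed.

End Elements.

(** * Scales *)

Section Scales.
Context {d : Order.disp_t} {L : frameType d}.
Implicit Types (a : L) (U V C D : rat -> L).

(** [U r] and [V r] stand for the open sets where a real-valued function on [a]
    is greater, respectively smaller, than [r]. *)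
Definition is_scale a U V : Prop :=
  (forall r, U r `&` V r = \bot) /\ (forall r s, r < s -> U r `|` V s = a).

Definition upper_limit U (p : rat) : L :=
  fsup [set U r | r in [set r | p < r]]%classic.

Definition lower_limit V (q : rat) : L :=
  fsup [set V s | s in [set s | s < q]]%classic.

Definition rounded_scale U V : Prop :=
  (forall p, U p = upper_limit U p) /\ (forall q, V q = lower_limit V q).

Lemma rat_dense (r s : rat) : r < s -> exists2 m, r < m & m < s.
Proof. by move=> rs; have [] := midf_lt rs; eexists; eassumption. Qed.

(** Negating the function exchanges the two families, so that it is enough to
    prove the properties of the first one. *)
Lemma scale_opp a U V : is_scale a U V ->
  is_scale a (fun r => V (- r)%R) (fun r => U (- r)%R).
Proof.
move=> [UV0 UVa]; split=> [r|r s rs]; first by rewrite meetC.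
by rewrite joinC; apply: UVa; rewrite ltrN2.
Qed.

Lemma upper_limit_opp V p :
  upper_limit (fun r => V (- r)%R) p = lower_limit V (- p)%R.
Proof.
apply/le_anti/andP; split; apply/fsup_le => _ [r /= pr <-]; apply: fsup_ub.
  by exists (- r)%R; rewrite //= ltrN2.
by exists (- r)%R; rewrite /= ?opprK // ltrNr.
Qed.

Lemma scale_le a U V : is_scale a U V -> forall r, U r <= a.
Proof. by move=> [_ UVa] r; rewrite -(UVa r (r + 1)%R) ?leUl // ltrDl. Qed.

Lemma scale_anti a U V : is_scale a U V -> forall r s, r <= s -> U s <= U r.
Proof.
move=> UV r s; rewrite le_eqVlt => /predU1P[->//|rs].
have Ua := scale_le UV s; move: UV => [UV0 UVa].
by rewrite leEmeet -{2}(meet_l Ua) -(UVa r s rs) meetUr UV0 joinx0.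
Qed.

Lemma scale_mono a U V : is_scale a U V -> forall r s, r <= s -> V r <= V s.
Proof.
move=> /scale_opp/scale_anti h r s rs.
by have := h (- s)%R (- r)%R; rewrite !opprK lerN2; apply.
Qed.

Lemma scale_disjoint a U V : is_scale a U V ->
  forall p q, q <= p -> U p `&` V q = \bot.
Proof.
move=> UV p q qp; apply/le_anti; rewrite le0x andbT -(UV.1 p).
by rewrite leI2 // (scale_mono UV).
Qed.

Lemma scale_round a U V : is_scale a U V ->
  is_scale a (upper_limit U) (lower_limit V).
Proof.
move=> UV; split=> [r|r s rs].
  apply/le_anti; rewrite le0x andbT; apply: meet_fsup2 => i j /= ri jr.
  by rewrite (scale_disjoint UV) // ltW // (lt_trans jr).
apply/le_anti/andP; split.
  rewrite leUx; apply/andP; split; apply/fsup_le => _ [i _ <-].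
    exact: (scale_le UV).
  by have := scale_le (scale_opp UV) (- i)%R; rewrite opprK.
have [m rm ms] := rat_dense rs; have [n mn ns] := rat_dense ms.
by rewrite -(UV.2 _ _ mn) leU2 //; apply: fsup_ub; [exists m|exists n].
Qed.

Lemma rounded_limits U V : rounded_scale (upper_limit U) (lower_limit V).
Proof.
have up W p : upper_limit W p = upper_limit (upper_limit W) p.
  apply/le_anti/andP; split; apply/fsup_le => _ [r /= pr <-].
    have [m pm mr] := rat_dense pr.
    by apply: (@le_trans _ _ (upper_limit W m)); apply: fsup_ub;
      [exists r|exists m].
  by apply: fsup_mono_image => s; apply: lt_trans.
split=> [//|q].
have E W r : lower_limit W r = upper_limit (fun x => W (- x)%R) (- r)%R.
  by rewrite upper_limit_opp opprK.
rewrite E up E; congr (upper_limit _ _).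
by apply/funext => x; rewrite upper_limit_opp.
Qed.

(** On [a], the covering [U r `|` V s = a] and the disjointness of [D] and [C]
    leave no room for [D]: if [r < s] then [U s <= a `&` D s <= U r]. *)
Lemma scale_ext_round a U V C D :
  is_scale a U V -> rounded_scale U V -> is_scale \top D C ->
  (forall r, U r <= D r) -> (forall r, V r <= C r) ->
  (forall p, a `&` upper_limit D p = U p) /\
  (forall q, a `&` lower_limit C q = V q).
Proof.
have up U' V' C' D' : is_scale a U' V' -> (forall p, U' p = upper_limit U' p) ->
    is_scale \top D' C' -> (forall r, U' r <= D' r) ->
    (forall r, V' r <= C' r) -> forall p, a `&` upper_limit D' p = U' p.
  move=> UV rU DC UD VC p; apply/le_anti/andP; split; last first.
    rewrite lexI (scale_le UV) rU; apply/fsup_le => _ [r pr <-].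
    by apply: (le_trans (UD r)); apply: fsup_ub; exists r.
  rewrite meet_fsup; apply/fsup_le => _ [_ [r pr <-] <-].
  rewrite -(UV.2 _ _ pr) meetUl leUx leIl /=.
  apply: (@le_trans _ _ (C' r `&` D' r)); first by rewrite leI2 ?VC.
  by rewrite meetC DC.1 le0x.
move=> UV [rU rV] DC UD VC; split; first exact: (up _ _ _ _ UV rU DC UD VC).
move=> q; have rV' p : V (- p)%R = upper_limit (fun r => V (- r)%R) p.
  by rewrite upper_limit_opp.
have := up _ _ _ _ (scale_opp UV) rV' (scale_opp DC) (fun r => VC _)
  (fun r => UD _) (- q)%R.
by rewrite upper_limit_opp opprK.
Qed.

(** [U p `&` V q] is the image of the open interval [(p, q)].  The covering
    property gives the relation for the union of overlapping intervals, and
    roundedness the one approximating an interval from inside. *)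
Lemma frame_hom_of_scale U V p0 q0 :
  is_scale \top U V -> rounded_scale U V -> U p0 = \top -> V q0 = \top ->
  exists2 h : frame_reals -> L,
    frame_hom h & forall p q, h (real_gen p q) = U p `&` V q.
Proof.
move=> UV [rU rV] Up0 Vq0; apply: (frame_reals_univ (f := fun p q => U p `&` V q)).
have aU := scale_anti UV; have mV := scale_mono UV.
split.
- move=> p q r s; rewrite meetACA; congr (_ `&` _).
    have [pr|/ltW rp] := leP p r; first exact/meet_r/aU.
    exact/meet_l/aU.
  have [qs|/ltW sq] := leP q s; first exact/meet_l/mV.
  exact/meet_r/mV.
- move=> p q r s pr rq qs; apply/le_anti/andP; split.
    by rewrite leUx leI2 ?mV //= leI2 ?aU.
  rewrite -[X in X <= _]meetx1 -(UV.2 _ _ rq) meetUr joinC.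
  rewrite leU2 // lexI ?leIr ?andbT.
    by rewrite (le_trans (leIl _ _)) ?leIl.
  by rewrite (le_trans (leIl _ _)) ?leIr.
- move=> p q; apply/le_anti/andP; split; last first.
    by apply/fsup_le => _ [[r s] /= [pr rs sq] <-]; rewrite leI2 ?aU ?mV ?ltW.
  rewrite {1}rU {1}rV; apply: meet_fsup2 => r s /= pr sq.
  have [rs|sr] := ltP r s; last by rewrite (scale_disjoint UV) ?le0x.
  by apply: fsup_ub; exists (r, s).
- apply/le_anti; rewrite lex1 andbT; apply: fsup_ub; exists (p0, q0) => //=.
  by rewrite Up0 Vq0 meetx1.
Qed.

(** * The members of a scale on a cozero element are cozero *)

(** Subdividing the interval from [s] to [r] interpolates between [U r] and
    [U s] inside [downset a]; meeting with an interpolation between [x] and [a]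
    in [L] makes the witnesses valid in [L]. *)
Lemma scale_completely_below a U V x (r s : rat) :
  is_scale a U V -> s < r -> completely_below x a ->
  completely_below (x `&` U r) (U s).
Proof.
move=> UV sr [c [c0 c1 cb]].
pose e q := U (r + q * (s - r))%R.
exists (fun q => c q `&` e q); split.
- by rewrite c0 /e mul0r addr0.
- by rewrite c1 /e mul1r subrKC meet_r ?(scale_le UV).
move=> q q' q0 qq' q'1; have [t [ct tc]] := cb q q' q0 qq' q'1.
have ca : c q' <= a.
  move: q'1; rewrite -c1 le_eqVlt => /predU1P[->//|q'1].
  by apply/rather_below_le/cb => //; rewrite (le_trans q0) ?ltW.
have lt_e : (r + q' * (s - r) < r + q * (s - r))%R.
  by rewrite ltrD2l ltr_nM2r // subr_lt0.
have := UV.2 _ _ lt_e; have := UV.1 (r + q * (s - r))%R.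
rewrite -/(e q) -/(e q'); set w := V _ => ew ewa.
exists (t `|` w); split.
  by rewrite meetUr -meetA (meetC (e q)) meetA ct meet0x join0x -meetA ew meetx0.
apply/le_anti; rewrite lex1 /= joinIr lexI; apply/andP; split.
  by rewrite -tc leUx leUr andbT -joinA leUl.
by rewrite -joinA (joinC w) ewa -tc leU2.
Qed.

Lemma scale_cozero_up a U V : cozero a -> is_scale a U V ->
  (forall p, U p = upper_limit U p) -> forall p, cozero (U p).
Proof.
move=> [u [ua a_u]] UV rU p.
pose I := (nat * {r : rat | p < r})%type.
apply: (cozero_countable (u := fun i : I => u i.1 `&` U (val i.2))).
  by move=> i; apply: (scale_completely_below UV) => //; apply: (valP i.2).
apply/le_anti/andP; split; last first.
  apply/fsup_le => _ [i _ <-]; apply: (le_trans (leIr _ _)).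
  by apply: (scale_anti UV); apply/ltW/(valP i.2).
rewrite -(meet_r (scale_le UV p)) a_u {1}rU; apply: meet_fsup2 => n r _ pr.
by apply: fsup_ub; exists (n, exist _ r pr).
Qed.

Lemma scale_cozero a U V : cozero a -> is_scale a U V -> rounded_scale U V ->
  (forall p, cozero (U p)) /\ (forall q, cozero (V q)).
Proof.
move=> ca UV [rU rV]; split; first exact: (scale_cozero_up ca UV).
move=> q; rewrite -(opprK q); apply: (scale_cozero_up ca (scale_opp UV)).
by move=> p; rewrite upper_limit_opp.
Qed.

(** * Extending a bounded scale *)

(** Only inequalities are asked between the two scales, since equality on [a]
    is restored by rounding.  The last clause says that the extended function is
    bounded, which ensures that the intervals [(p, q)] cover [\top]. *)
Definition scale_extends U V : Prop :=
  exists D C, [/\ is_scale \top D C,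
    forall r, U r <= D r, forall r, V r <= C r
    & exists p q, D p = \top /\ C q = \top].

(** The extension is [0] on [pseudocompl a], which is therefore added to [U r]
    when [r < 0] and to [V r] when [0 <= r]. *)
Lemma scale_ext_complemented a U V p0 q0 :
  complemented a -> is_scale a U V -> U p0 = a -> V q0 = a ->
  scale_extends U V.
Proof.
move=> ca UV Up0 Vq0; set a' := pseudocompl a.
have disj x y : x <= a -> y <= a' -> x `&` y = \bot.
  move=> xa ya; apply/le_anti; rewrite le0x andbT -(meet_pseudocompl a).
  exact: leI2.
have Ua := scale_le UV.
have Va r : V r <= a by have := scale_le (scale_opp UV) (- r)%R; rewrite opprK.
exists (fun r => U r `|` (if r < 0%R then a' else \bot)).
exists (fun r => V r `|` (if r < 0%R then \bot else a')).
split; [split=> [r|r s rs]| | |].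
- rewrite meetUl !meetUr UV.1 join0x (disj (U r)) ?join0x //; last by case: ifP.
  rewrite meetC (disj (V r)) ?join0x //; last by case: ifP.
  by case: ifP => _; rewrite ?meetx0 ?meet0x.
- rewrite joinACA (UV.2 _ _ rs); case: (ltP r 0%R) => r0.
    apply/le_anti; rewrite lex1 /= -ca leU2 //.
    by case: ifP => _; rewrite ?leUl.
  by rewrite ltNge (le_trans r0 (ltW rs)) /= join0x.
- by move=> r; rewrite leUl.
- by move=> r; rewrite leUl.
exists (Order.min p0 (- 1)%R), (Order.max q0 0%R).
have -> : Order.min p0 (- 1)%R < 0%R by rewrite gt_min ltrN10 orbT.
rewrite [X in if X then _ else _]ltNge le_max lexx orbT /=; split.
  apply/le_anti; rewrite lex1 -ca leU2 // -Up0; apply: (scale_anti UV).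
  by rewrite ge_min lexx.
apply/le_anti; rewrite lex1 -ca leU2 // -Vq0; apply: (scale_mono UV).
by rewrite le_max lexx.
Qed.

(** All the [D r] are complemented and [C r] is the complement of [D r], so the
    covering property reduces to [D] being decreasing.  The only dangerous case,
    [V s] complemented and [U r] complemented with [r < s], would make
    [a = U r `|` V s] complemented. *)
Lemma scale_ext_noncomplemented a U V p0 q0 :
  ~ complemented a -> is_scale a U V ->
  (forall r, complemented (U r) \/ complemented (V r)) ->
  U p0 = a -> V q0 = a -> scale_extends U V.
Proof.
move=> nca UV cUV Up0 Vq0.
have Va r : V r <= a by have := scale_le (scale_opp UV) (- r)%R; rewrite opprK.
have excl r s : r < s -> complemented (U r) -> ~ complemented (V s).
  by move=> rs cU cV; apply: nca; rewrite -(UV.2 _ _ rs); apply: complementedU.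
pose B r := `[< complemented (V r) >].
pose D r := if B r then pseudocompl (V r) else U r.
pose C r := if B r then V r else pseudocompl (U r).
have DCr r : D r `|` C r = \top.
  rewrite /D /C /B; case: asboolP => [cV|ncV]; first by rewrite joinC.
  by case: (cUV r).
have D_anti r s : r < s -> D s <= D r.
  move=> rs; rewrite /D /B; case: asboolP => [cVs|ncVs].
    case: asboolP => [cVr|ncVr]; last first.
      by case: (cUV r) => // cUr; case: (excl r s).
    apply: le_pseudocompl; apply/le_anti; rewrite le0x andbT.
    rewrite -(meet_pseudocompl (V s)) meetC leI2 //.
    by rewrite (scale_mono UV) // ltW.
  have Usr : U s <= U r by rewrite (scale_anti UV) // ltW.
  case: asboolP => // _; apply: le_pseudocompl; apply/le_anti.
  by rewrite le0x andbT -(UV.1 r) leI2.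
exists D, C; split; [split=> [r|r s rs]| | |].
- rewrite /D /C; case: ifP => _; last exact: meet_pseudocompl.
  by rewrite meetC meet_pseudocompl.
- by apply/le_anti; rewrite lex1 -(DCr s) leU2 ?D_anti.
- by move=> r; rewrite /D; case: ifP => // _; apply/le_pseudocompl/UV.1.
- move=> r; rewrite /C; case: ifP => // _; apply/le_pseudocompl.
  by rewrite meetC UV.1.
have pc0 : pseudocompl \bot = \top :> L.
  by apply/le_anti; rewrite lex1 le_pseudocompl ?meetx0.
(* Where [U] fills [a], [V] is [\bot], hence complemented, and conversely. *)
have Vp0 : V p0 = \bot by rewrite -(meet_r (Va p0)) -Up0 UV.1.
have Uq0 : U q0 = \bot by rewrite -(meet_l (scale_le UV q0)) -Vq0 UV.1.
exists p0, q0; rewrite /D /C /B; split.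
  by rewrite asboolT Vp0 //; apply: complemented_bot.
by rewrite asboolF ?Vq0 // Uq0.
Qed.

End Scales.

(** * Homomorphisms from the reals to a downset *)

Lemma frame_homU d d' (L : frameType d) (M : frameType d') (h : L -> M) :
  frame_hom h -> forall x y, h (x `|` y) = h x `|` h y.
Proof.
move=> [_ _ hS] x y; rewrite !fsup_pair hS; congr fsup; apply/seteqP; split.
  by move=> _ [z [->|->] <-]; [left|right].
by move=> _ [->|->]; [exists x|exists y] => //; [left|right].
Qed.

Lemma frame_hom_comp d1 d2 d3 (L : frameType d1) (M : frameType d2)
    (N : frameType d3) (f : M -> N) (g : L -> M) :
  frame_hom f -> frame_hom g -> frame_hom (f \o g).
Proof.
move=> [f1 fI fS] [g1 gI gS]; split=> /=; first by rewrite g1 f1.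
  by move=> x y; rewrite gI fI.
by move=> S; rewrite gS fS image_comp.
Qed.

Lemma frame_hom_real_relations d (M : frameType d) (g : frame_reals -> M) :
  frame_hom g -> real_relations (fun p q => g (real_gen p q)).
Proof.
move=> hg; have [g1 gI gS] := hg; have [rI rU rin r1] := real_gen_relations.
split=> [p q r s|p q r s pr rq qs|p q|].
- by rewrite -gI rI.
- by rewrite -(frame_homU hg) rU.
- by rewrite rin gS image_comp.
- by rewrite -g1 r1 gS image_comp.
Qed.

(** As [f p0 q0 = \top], the function lies between [p0] and [q0], and the rays
    [(r, +oo)] and [(-oo, r)] are [f r q0] and [f p0 r]. *)
Lemma bounded_scale d (M : frameType d) (f : rat -> rat -> M) p0 q0 :
  real_relations f -> f p0 q0 = \top ->
  let U := fun r => f r q0 in let V := fun r => f p0 r in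
  [/\ is_scale \top U V, rounded_scale U V & forall p q, f p q = U p `&` V q].
Proof.
move=> [fI fU fin ftop] f1 U V.
have fdown p q r s : r <= p -> q <= s -> f p q <= f r s.
  by move=> rp qs; rewrite leEmeet fI (max_l rp) (min_l qs).
have f0 p q : q <= p -> f p q = \bot.
  move=> qp; rewrite fin; apply/le_anti; rewrite le0x andbT.
  apply/fsup_le => _ [[r s] /= [pr rs sq] <-].
  by have := lt_le_trans (lt_trans pr (lt_trans rs sq)) qp; rewrite ltxx.
split; [split=> [r|r s rs]|split=> [p|q]|].
- by rewrite fI f0 // le_max ge_min lexx !orbT.
- have [p0r|/ltW rp0] := leP p0 r; last first.
    by apply/le_anti; rewrite lex1 -f1 lexUl // fdown.
  have [sq0|/ltW q0s] := leP s q0; last first.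
    by apply/le_anti; rewrite lex1 -f1 lexUr // fdown.
  by rewrite joinC fU.
- apply/le_anti/andP; split; last first.
    by apply/fsup_le => _ [r /= pr <-]; apply: fdown => //; apply: ltW.
  rewrite [U p]fin; apply/fsup_le => _ [[r s] /= [pr rs sq] <-].
  apply: (@le_trans _ _ (U r)); first exact/fdown/ltW.
  by apply: fsup_ub; exists r.
- apply/le_anti/andP; split; last first.
    by apply/fsup_le => _ [r /= rq <-]; apply: fdown => //; apply: ltW.
  rewrite [V q]fin; apply/fsup_le => _ [[r s] /= [pr rs sq] <-].
  apply: (@le_trans _ _ (V s)); first by apply: fdown => //; apply: ltW.
  by apply: fsup_ub; exists s.
- by move=> p q; rewrite fI (minC q0) -fI f1 meetx1.
Qed.

Section Downset.
Context {d : Order.disp_t} {L : frameType d} (a : L).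
Implicit Types x y : downset a.

Lemma val_downI x y : val (x `&` y) = val x `&` val y.
Proof. by []. Qed.

Lemma val_down_fsup (S : set (downset a)) :
  val (fsup S) = fsup [set val x | x in S]%classic.
Proof. by []. Qed.

Lemma val_downU x y : val (x `|` y) = val x `|` val y.
Proof.
rewrite !fsup_pair val_down_fsup; congr fsup; apply/seteqP; split.
  by move=> _ [z [->|->] <-]; [left|right].
by move=> _ [->|->]; [exists x|exists y] => //; [left|right].
Qed.

Lemma val_down1 : val (\top : downset a) = a.
Proof.
apply/le_anti; rewrite (valP (\top : downset a)) /=.
by have := lex1 (down_proj a a); rewrite -Order.le_val SubK meetxx.
Qed.

Lemma val_down0 : val (\bot : downset a) = \bot.
Proof.
apply/le_anti; rewrite le0x andbT.
by have := le0x (down_proj a \bot); rewrite -Order.le_val [leRHS]SubK meetx0.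
Qed.

Lemma down_proj_hom : frame_hom (down_proj a).
Proof.
split.
- by apply/val_inj; rewrite SubK val_down1 meetx1.
- by move=> x y; apply/val_inj; rewrite val_downI !SubK meetACA meetxx.
- move=> S; apply/val_inj; rewrite SubK val_down_fsup meet_fsup image_comp.
  by congr fsup; apply: eq_imagel => x _ /=; rewrite SubK.
Qed.

Lemma down_scale (U V : rat -> downset a) :
  is_scale \top U V -> rounded_scale U V ->
  is_scale a (val \o U) (val \o V) /\ rounded_scale (val \o U) (val \o V).
Proof.
move=> [UV0 UV1] [rU rV]; split; split=> /=.
- by move=> r; rewrite -val_downI UV0 val_down0.
- by move=> r s rs; rewrite -val_downU (UV1 _ _ rs) val_down1.
- by move=> p; rewrite rU val_down_fsup image_comp.
- by move=> q; rewrite rV val_down_fsup image_comp.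
Qed.

End Downset.

(** * P_F-frames are F-frames *)

Theorem proposition3p4 (d : Order.disp_t) (L : frameType d) :
  completely_regular L -> PF_frame L -> F_frame L.
Proof.
move=> _ PF a ca; split; first exact: down_proj_hom.
  move=> y; exists (val y); apply/val_inj; rewrite SubK meet_r //.
  exact: (valP y).
move=> g hg [p0 [q0 g1]].
have [dUV drUV gE] := bounded_scale (frame_hom_real_relations hg) g1.
have [UV rUV] := down_scale dUV drUV.
move: UV rUV; set U := val \o _; set V := val \o _ => UV rUV.
have Up0 : U p0 = a by rewrite /U /= g1 val_down1.
have Vq0 : V q0 = a by rewrite /V /= g1 val_down1.
have [D [C [DC UD VC [p1 [q1 [Dp1 Cq1]]]]]] : scale_extends U V.
  have [cU cV] := scale_cozero ca UV rUV.
  have [ac|nac] := pselect (complemented a).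
    exact: (scale_ext_complemented ac UV Up0 Vq0).
  apply: (scale_ext_noncomplemented nac UV _ Up0 Vq0) => r.
  exact/PF/UV.1.
have [aD aC] := scale_ext_round UV rUV DC UD VC.
have D1 : upper_limit D (p1 - 1)%R = \top.
  apply/le_anti; rewrite lex1 -Dp1; apply: fsup_ub; exists p1 => //=.
  by rewrite ltrBlDr ltrDl.
have C1 : lower_limit C (q1 + 1)%R = \top.
  apply/le_anti; rewrite lex1 -Cq1; apply: fsup_ub; exists q1 => //=.
  by rewrite ltrDl.
have [h hh hE] := frame_hom_of_scale (scale_round DC) (rounded_limits D C) D1 C1.
exists h => //; apply: frame_reals_uniq => //.
  exact: frame_hom_comp (down_proj_hom a) hh.
move=> p q; apply/val_inj; rewrite gE val_downI [RHS]SubK hE.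
by rewrite -[in RHS](meetxx a) meetACA aD aC.
Qed.
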